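(* Let $k \geq 2$ be an integer and let $q \geq 2$ be a prime power, both fixed, and let $c$ be any constant with $kc < \zeta_q(k)$, where $\zeta_q(s) = (1-q^{1-s})^{-1}$. If $n$ is sufficiently large, then there exist monic polynomials $F \in \mathbb F_q[x]$ of degree at most $n$ such that the interval $\mathcal I_q(F,h)$ contains no $k$-free polynomial for any integer length $h \ge 0$ satisfying \[ q^{h+1} \leq \frac{cn}{\log_q n}. \]
   Context: $\mathbb F_q$ denotes the finite field with $q$ elements. For $F \in \mathbb F_q[x]$ and an integer $h$, the interval of length $h$ centered at $F$ is $\mathcal I_q(F,h) = \{ Q \in \mathbb F_q[x] : \deg(F-Q) \le h\}$. A polynomial in $\mathbb F_q[x]$ is $k$-free if it is not divisible by the $k$th power of any non-constant polynomial (equivalently, it has no irreducible factor of multiplicity $\ge k$). *)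

(* Defs.v *)
From HB Require Import structures.
From mathcomp Require Import all_boot all_order all_algebra.
From mathcomp Require Import all_classical all_reals all_analysis.

Set Implicit Arguments.
Unset Strict Implicit.
Unset Printing Implicit Defensive.

Import Order.TTheory GRing.Theory Num.Theory.
Local Open Scope classical_set_scope.
Local Open Scope ring_scope.

(* [size p] is [deg p + 1], and [size 0 = 0], so [deg p <= h] with the
   convention [deg 0 = -oo] reads [size p <= h.+1]. *)
Definition poly_interval (K : fieldType) (F : {poly K}) (h : nat) :
    set {poly K} :=
  [set Q | (size (F - Q)%R <= h.+1)%N].

Definition kfree (K : fieldType) (k : nat) (Q : {poly K}) : Prop :=
  forall P : {poly K}, (1 < size P)%N -> ~~ (P ^+ k %| Q).

Definition zetaq (R : realType) (q : nat) (s : R) : R :=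
  (1 - q%:R `^ (1 - s))^-1.

Definition logq (R : realType) (q : nat) (x : R) : R := ln x / ln q%:R.

(* Main.v *)
(** Fix [y] with [k c < Z], where [Z] is the sum of [q^(d(1-k))] over [d <= y], and let [t]
    be maximal with [q^t <= c n / log_q n]. Taking [F] divisible by all [P^k] with
    [1 <= deg P <= y] settles every [F + A], [deg A < t], for which [A] itself is divisible
    by such a [P^k]. The map [(g, r) |-> g r^k], with [g] free of such factors and [r] monic
    of degree at most [y], is injective; since the surviving [g] are periodic modulo the
    product of the [P^k], at most [q^t / Z] of the [A] survive. Each survivor receives its
    own irreducible polynomial of degree between [y + 1] and [m = log_q n + O(1)], and the
    Chinese remainder theorem produces an [F] of degree at most [k m q^t / Z + O(1)], which
    is about [(k c / Z) n < n]. *)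

Require Import Defs.
From HB Require Import structures.
From mathcomp Require Import all_boot all_order all_algebra.
From mathcomp Require Import all_fingroup all_solvable all_field.
From mathcomp Require Import all_classical all_reals all_analysis.
From mathcomp Require Import qpoly zify ring lra.

Set Implicit Arguments.
Unset Strict Implicit.
Unset Printing Implicit Defensive.

Import Order.TTheory GRing.Theory Num.Theory.
Local Open Scope classical_set_scope.
Local Open Scope ring_scope.

(** * Counting irreducible polynomials over a finite field *)

Lemma exists_irreducible_dvdp (F : fieldType) (p : {poly F}) :
  (1 < size p)%N ->
  exists r : {poly F}, [/\ r \is monic, irreducible_poly r & r %| p].
Proof.
elim: (size p) {-2}p (leqnn (size p)) => [|n IHn] {}p sp p_gt1.
  by rewrite leqn0 in sp; rewrite (eqP sp) in p_gt1.
have [[d [d1 dp dNp]]|no_d] :=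
    EM (exists d : {poly F}, [/\ size d != 1%N, d %| p & ~~ (d %= p)]).
  have pN0 : p != 0 by rewrite -size_poly_gt0 ltnW.
  have d_lt : (size d < size p)%N.
    by rewrite ltn_neqAle dvdp_leq // andbT; apply: contra dNp; rewrite dvdp_size_eqp.
  have d_gt1 : (1 < size d)%N.
    by rewrite ltn_neqAle eq_sym d1 size_poly_gt0 (dvdpN0 dp).
  have [||r [mr ir rd]] := IHn d => //; first by rewrite -ltnS (leq_trans d_lt).
  by exists r; split=> //; apply: dvdp_trans dp.
have lc : (lead_coef p)^-1 != 0.
  by rewrite invr_eq0 lead_coef_eq0 -size_poly_gt0 ltnW.
exists ((lead_coef p)^-1 *: p); split.
- by rewrite monicE lead_coefZ mulVf // -invr_eq0.
- split=> [|d d1]; first by rewrite size_scale.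
  rewrite dvdpZr // => dp; rewrite (eqp_rtrans (eqp_scale _ lc)).
  by apply/negPn/negP => dNp; apply: no_d; exists d; split.
- by rewrite dvdpZl.
Qed.

Lemma size_XnsubX (R : nzRingType) (n : nat) :
  (1 < n)%N -> size ('X^n - 'X : {poly R}) = n.+1.
Proof. by move=> n1; rewrite size_polyDl size_polyXn // size_polyN size_polyX ltnS. Qed.

(* The residue field of [P] consists of roots of [X^(q^m) - X]. *)
Lemma irreducible_dvd_genPoly_size (K : finFieldType) (P : {poly K}) (m : nat) :
  (0 < m)%N -> irreducible_poly P -> P %| 'X^(#|K| ^ m) - 'X ->
  (size P <= m.+1)%N.
Proof.
move=> m_gt0 irrP dvdP.
have [L dimL [z Pz Lz]] := irredp_FAdjoin irrP.
have [p p_prime pcharK] := finPcharP K.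
have pnat_q : p.-nat (#|K| ^ m)%N.
  rewrite pnatX; apply/orP; left.
  by have := abelem_pgroup (fin_ring_pchar_abelem pcharK); rewrite /pgroup cardsT.
have pnatL : [pchar L].-nat (#|K| ^ m)%N.
  by rewrite (eq_pnat _ (pchar_lalg L)) (eq_pnat _ (pcharf_eq pcharK)).
have Q_gt1 : (1 < #|K| ^ m)%N by rewrite -[1%N](exp1n m) ltn_exp2r ?finNzRing_gt1.
have fixK (a : K) : a ^+ (#|K| ^ m) = a.
  by elim: (m) => [|i IHi]; rewrite ?expn0 // expnSr exprM IHi expf_card.
have fixz : z ^+ (#|K| ^ m) = z.
  have : root (map_poly (in_alg L) ('X^(#|K| ^ m) - 'X)) z.
    by have := dvdP; rewrite -(dvdp_map (in_alg L)) => /dvdpP[u ->]; rewrite rootM Pz orbT.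
  by rewrite rmorphB /= map_polyXn map_polyX rootE !hornerE subr_eq0 => /eqP.
(* Raising to the power [#|K| ^ m] is additive on [L] and fixes both [K] and [z], hence all of
   [L = K(z)]. So [X^(q^m) - X] has [q^(deg P)] roots in [L], which forces [deg P <= m]. *)
have fixL (y : L) : y ^+ (#|K| ^ m) = y.
  have /Fadjoin_polyP[r0 /polyOver1P[r ->] ->] : y \in <<1; z>>%VS by rewrite Lz memvf.
  elim/poly_ind: r => [|r c IHr]; first by rewrite rmorph0 horner0 expr0n gtn_eqF // ltnW.
  rewrite rmorphD rmorphM /= map_polyX map_polyC /= !hornerE exprDn_pchar //.
  by rewrite exprMn IHr fixz exprZn fixK expr1n.
have cardL : #|finvect_type L| = (#|K| ^ (size P).-1)%N.
  rewrite -dimL -[RHS](@card_vspace K (finvect_type L)).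
  by apply: eq_card => v; rewrite memvf.
have GN0 : 'X^(#|K| ^ m) - 'X != 0 :> {poly finvect_type L}.
  by rewrite -size_poly_gt0 size_XnsubX.
have := max_poly_roots GN0 (rs := enum (finvect_type L)).
rewrite enum_uniq -cardE cardL size_XnsubX // ltnS leq_exp2l ?finNzRing_gt1 // => Hle.
have P_gt0 : (0 < size P)%N by rewrite size_poly_gt0 irredp_neq0.
rewrite -(prednK P_gt0) ltnS; apply: Hle => //.
by apply/allP => y _; rewrite rootE !hornerE fixL subrr.
Qed.

(* [X^(q^m) - X] is squarefree, hence divides the product of the irreducible
   polynomials of degree at most [m]; comparing degrees gives the count. *)
Lemma many_irreducibles (K : finFieldType) (m : nat) : (0 < m)%N ->
  (#|K| ^ m <= m * #|[pred P : {poly_(m.+1) K} |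
      ((P : {poly K}) \is monic) && irreducibleb P]|)%N.
Proof.
move=> m_gt0; set S := [pred P | _].
pose G : {poly K} := 'X^(#|K| ^ m) - 'X.
have q_gt1 := finNzRing_gt1 K.
have Q_gt1 : (1 < #|K| ^ m)%N by rewrite -[1%N](exp1n m) ltn_exp2r.
have sG : size G = (#|K| ^ m).+1 by rewrite size_XnsubX.
have GN0 : G != 0 by rewrite -size_poly_gt0 sG.
pose Pi := \prod_(P in S) (P : {poly K}).
have SN0 (P : {poly_(m.+1) K}) : P \in S -> (P : {poly K}) != 0.
  by case/andP=> /monic_neq0.
have PiN0 : Pi != 0 by apply/prodf_neq0 => P /SN0.
have Gdvd : G %| Pi.
  have [C Geq] : exists C, G = C * gcdp G Pi.
    by apply/dvdpP; exact: dvdp_gcdl.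
  have [C_gt1|C_le1] := ltnP 1 (size C).
    have [P [mP irrP PC]] := exists_irreducible_dvdp C_gt1.
    have PG : P %| G by rewrite Geq dvdp_mulr.
    have sP := irreducible_dvd_genPoly_size m_gt0 irrP PG.
    have PPi : P %| Pi.
      rewrite /Pi (bigD1 (npolyp m.+1 P)) /=; last first.
        by rewrite inE /= npolypK // mP; apply/irreducibleP.
      by rewrite npolypK // dvdp_mulr.
    have [u Geq2] : exists u, G = u * (P * P).
      by apply/dvdpP; rewrite Geq dvdp_mul // dvdp_gcd PG.
    have : P %| G^`().
      rewrite Geq2 !derivM; apply: dvdp_add; first by rewrite !dvdp_mull.
      by rewrite dvdp_mull // dvdp_add ?dvdp_mulIl ?dvdp_mulIr.
    have -> : G^`() = - 1.
      rewrite derivB derivXn derivX -mulr_natr natrX.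
      have -> : #|K|%:R = 0 :> {poly K}.
        have := expg_cardG (finset.in_setT (1 : K)); rewrite cardsT FinRing.zmodXgE => q0.
        by rewrite -polyC_natr q0.
      by rewrite expr0n gtn_eqF // mulr0 sub0r.
    rewrite dvdpNr dvdp1 => /eqP s1.
    by have := irrP.1; rewrite s1.
  have CN0 : C != 0 by apply: contraNneq GN0 => C0; rewrite Geq C0 mul0r.
  have /size_poly1P[c c0 CE] : size C == 1%N by rewrite eqn_leq C_le1 size_poly_gt0.
  by rewrite Geq CE mul_polyC dvdpZl // dvdp_gcdr.
have : (size G <= size Pi)%N by rewrite dvdp_leq.
rewrite sG size_prod; last by move=> P /SN0.
have : (\sum_(P in S) size (P : {poly K}) <= \sum_(P in S) m.+1)%N.
  by apply: leq_sum => P _; exact: size_npoly.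
rewrite sum_nat_const mulnS (mulnC #|S|).
move: (\sum_(P in S) _)%N (#|K| ^ m)%N (m * _)%N => u Q M.
by have -> : #|(fun P => P \in S)| = #|S| by []; lia.
Qed.

(** * Sieving by [k]-th powers of polynomials of degree at most [y] *)

(** Ranging over the finite type [{poly_(y.+1) K}] makes the condition boolean, so that survivors
    can be counted. *)
Definition kfree_upto (K : finFieldType) (k y : nat) (A : {poly K}) : bool :=
  [forall P : {poly_(y.+1) K},
    (1 < size (P : {poly K}))%N ==> ~~ ((P : {poly K}) ^+ k %| A)].

(** Any fixed common multiple of the small [P ^+ k] serves: its degree depends on [K], [k], [y] only
    and is absorbed for large [n]. *)
Definition sieve_modulus (K : finFieldType) (k y : nat) : {poly K} :=
  \prod_(P : {poly_(y.+1) K} | (P : {poly K}) != 0) (P : {poly K}) ^+ k.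

Definition sieve_count (K : finFieldType) (k y t : nat) : nat :=
  #|[pred A : {poly_t K} | kfree_upto k y A]|.

Section Sieve.
Variables (K : finFieldType) (k y : nat).
Local Notation W := (sieve_modulus K k y).
Local Notation q := #|K|.

Lemma kfree_uptoP (A : {poly K}) :
  reflect (forall P : {poly K}, (1 < size P)%N -> (size P <= y.+1)%N ->
             ~~ (P ^+ k %| A))
          (kfree_upto k y A).
Proof.
apply: (iffP forallP) => [H P P1 Py|H P]; last first.
  by apply/implyP => P1; apply: H => //; exact: size_npoly.
by have /implyP := H (npolyp y.+1 P); rewrite npolypK //; apply.
Qed.

Lemma sieve_modulus_neq0 : W != 0.
Proof. by apply/prodf_neq0 => P PN0; rewrite expf_neq0. Qed.

Lemma dvdp_sieve_modulus (P : {poly K}) :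
  P != 0 -> (size P <= y.+1)%N -> P ^+ k %| W.
Proof.
move=> PN0 Py; rewrite /sieve_modulus (bigD1 (npolyp y.+1 P)) ?npolypK //=.
by rewrite dvdp_mulr.
Qed.

Lemma kfree_upto_addM (A B : {poly K}) :
  kfree_upto k y (A + W * B) = kfree_upto k y A.
Proof.
apply/kfree_uptoP/kfree_uptoP => H P P1 Py; have := H P P1 Py.
all: by rewrite dvdp_addl // dvdp_mulr // dvdp_sieve_modulus // -size_poly_gt0 ltnW.
Qed.

(** Division by [W] identifies a polynomial of degree below [w + s] with its remainder and a
    quotient of degree below [s]; survival depends on the remainder alone. *)
Lemma sieve_count_periodic (w s : nat) : size W = w.+1 ->
  sieve_count K k y (w + s) = (sieve_count K k y w * q ^ s)%N.
Proof.
move=> sW; have WN0 := sieve_modulus_neq0.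
pose g (x : {poly_w K} * {poly_s K}) : {poly_(w + s) K} :=
  npolyp (w + s) ((x.1 : {poly K}) + W * (x.2 : {poly K})).
have ltW (a : {poly_w K}) : (size (a : {poly K}) < size W)%N.
  by rewrite sW ltnS size_npoly.
have gE x : g x = (x.1 : {poly K}) + W * (x.2 : {poly K}) :> {poly K}.
  rewrite npolypK // (leq_trans (size_polyD _ _)) // geq_max.
  rewrite (leq_trans (size_npoly _)) ?leq_addr //=.
  have [->|x2N0] := eqVneq (x.2 : {poly K}) 0; first by rewrite mulr0 size_poly0.
  by rewrite size_mul // sW addSn /= leq_add2l size_npoly.
have g_inj : injective g.
  move=> x x' /(congr1 val) /=; rewrite -!/(polyn _) !gE => e.
  have e1 : (x.1 : {poly K}) = (x'.1 : {poly K}).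
    move/(congr1 (fun p => p %% W)): e.
    by rewrite !(addrC (polyn _)) ![W * _]mulrC !modp_addl_mul_small.
  move: e; rewrite e1 => /addrI/(mulfI WN0) e2.
  by case: x x' e1 e2 => [a b] [a' b'] /= e1 e2; congr (_, _); apply: val_inj.
pose D := [predX [pred A : {poly_w K} | kfree_upto k y A] & {: {poly_s K}}].
rewrite /sieve_count -card_npoly -cardX -/D -(card_imset D g_inj).
apply: eq_card => x; apply/idP/imsetP => [xk|[[a b] /andP[/= ak _] ->]]; last first.
  by rewrite inE gE /= kfree_upto_addM.
have xE : (x : {poly K}) = (x : {poly K}) %% W + W * ((x : {poly K}) %/ W).
  by rewrite addrC mulrC -divp_eq.
have s1 : (size ((x : {poly K}) %% W)%R <= w)%N by rewrite -ltnS -sW ltn_modp.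
have s2 : (size ((x : {poly K}) %/ W)%R <= s)%N.
  by rewrite size_divp // sW leq_subLR size_npoly.
exists (npolyp w ((x : {poly K}) %% W), npolyp s ((x : {poly K}) %/ W)).
  by rewrite !inE /= npolypK // andbT; move: xk; rewrite inE {1}xE kfree_upto_addM.
by apply: val_inj; rewrite /= -/(polyn _) gE /= !npolypK.
Qed.

(* With [d = gcd r r'], [r = s d] and [r' = s' d], the coprimality of [s] and [s'] gives
   [s ^ k | g'] and [s' ^ k | g], so both are constant. *)
Lemma kfree_part_unique (g g' r r' : {poly K}) :
  kfree_upto k y g -> kfree_upto k y g' -> r \is monic -> r' \is monic ->
  (size r <= y.+1)%N -> (size r' <= y.+1)%N ->
  g * r ^+ k = g' * r' ^+ k -> r = r' /\ g = g'.
Proof.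
move=> gk gk' mr mr' sr sr' e.
suff err : r = r'.
  by split=> //; move: e; rewrite err => /mulIf -> //; rewrite expf_neq0 ?monic_neq0.
pose d := gcdp r r'.
have rN0 := monic_neq0 mr; have rN0' := monic_neq0 mr'.
have dN0 : d != 0 by rewrite gcdp_eq0 negb_and rN0.
have [s rE] : exists s, r = s * d by apply/dvdpP; exact: dvdp_gcdl.
have [s' rE'] : exists s, r' = s * d by apply/dvdpP; exact: dvdp_gcdr.
have cop : coprimep s s'.
  rewrite -[s](mulpK _ dN0) -[s' in coprimep _ s'](mulpK _ dN0) -rE -rE'.
  by apply: coprimep_div_gcd; rewrite rN0.
have e' : g * s ^+ k = g' * s' ^+ k.
  apply: (mulIf (expf_neq0 k dN0)).
  by rewrite -!mulrA -!exprMn -rE -rE'.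
have const (u v f : {poly K}) : u * d = v -> v != 0 -> (size v <= y.+1)%N ->
    kfree_upto k y f -> u ^+ k %| f -> u %= 1.
  move=> uv vN0 sv fk uf.
  have uN0 : u != 0 by apply: contraNneq vN0 => u0; rewrite -uv u0 mul0r.
  have su : (size u <= y.+1)%N by rewrite (leq_trans _ sv) // dvdp_leq // -uv dvdp_mulIl.
  rewrite -size_poly_eq1 eqn_leq size_poly_gt0 uN0 andbT leqNgt; apply/negP => u1.
  by have /kfree_uptoP/(_ u u1 su) := fk; rewrite uf.
have s1 : s %= 1.
  apply: (const s r g') => //.
  by rewrite -(Gauss_dvdpl _ (coprimep_expl k (coprimep_expr k cop))) -e' dvdp_mulIr.
have s1' : s' %= 1.
  apply: (const s' r' g) => //; rewrite coprimep_sym in cop.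
  by rewrite -(Gauss_dvdpl _ (coprimep_expl k (coprimep_expr k cop))) e' dvdp_mulIr.
apply/eqP; rewrite -eqp_monic // rE rE'.
by apply: eqp_mulr; rewrite (eqp_ltrans s1) eqp_sym.
Qed.

(** The products [g * r ^+ k], with [g] a survivor and [r] monic of degree [d <= y], are pairwise
    distinct by [kfree_part_unique], also for different [d], and all lie among the [q ^ t]
    polynomials of degree below [t]. *)
Lemma sieve_count_sum (t : nat) : (k * y <= t)%N ->
  (\sum_(d < y.+1) q ^ d * sieve_count K k y (t - k * d) <= q ^ t)%N.
Proof.
move=> kyt.
(* As [b] varies, [r d b] runs through the monic polynomials of degree [d]. *)
pose r d (b : {poly_d K}) : {poly K} := 'X^d + (b : {poly K}).
have ltb d (b : {poly_d K}) : (size (b : {poly K}) < size ('X^d : {poly K}))%N.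
  by rewrite size_polyXn ltnS size_npoly.
have size_r d b : size (r d b) = d.+1.
  by rewrite size_polyDl // size_polyXn.
have monic_r d b : r d b \is monic by rewrite monicE lead_coefDl // lead_coefXn.
pose f (d : 'I_y.+1) (x : {poly_d K} * {poly_(t - k * d) K}) : {poly_t K} :=
  npolyp t ((x.2 : {poly K}) * r d x.1 ^+ k).
have kdt (d : 'I_y.+1) : (k * d <= t)%N.
  by rewrite (leq_trans _ kyt) // leq_mul2l -ltnS ltn_ord orbT.
have fE d x : f d x = (x.2 : {poly K}) * r d x.1 ^+ k :> {poly K}.
  rewrite npolypK //; have [->|xN0] := eqVneq (x.2 : {poly K}) 0.
    by rewrite mul0r size_poly0.
  have rkN0 : r d x.1 ^+ k != 0 by rewrite expf_neq0 ?monic_neq0.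
  have -> : size ((x.2 : {poly K}) * r d x.1 ^+ k) = (size (x.2 : {poly K}) + k * d)%N.
    rewrite size_mul // -[size (r d x.1 ^+ k)]prednK ?size_poly_gt0 // size_exp size_r.
    by rewrite addnS /= (mulnC (nat_of_ord d)).
  by rewrite addnC -leq_subRL ?size_npoly.
pose D (d : 'I_y.+1) := [predX {: {poly_d K}} &
   [pred A : {poly_(t - k * d) K} | kfree_upto k y A]].
have f_eq (d d' : 'I_y.+1) x x' : x \in D d -> x' \in D d' -> f d x = f d' x' ->
    r d x.1 = r d' x'.1 /\ (x.2 : {poly K}) = (x'.2 : {poly K}).
  move=> /andP[_ xD] /andP[_ xD'] /(congr1 (@polyn K t)); rewrite !fE.
  by apply: kfree_part_unique => //; rewrite size_r.
have <- : (\sum_(d < y.+1) #|f d @: D d|)%N =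
          (\sum_(d < y.+1) q ^ d * sieve_count K k y (t - k * d))%N.
  apply: eq_bigr => d _; rewrite card_in_imset; first by rewrite cardX card_npoly.
  move=> x x' xD xD' /(f_eq _ _ _ _ xD xD')[e1 e2].
  case: x x' e1 e2 {xD xD'} => [b a] [b' a'] /= /addrI e1 e2.
  by congr (_, _); apply: val_inj.
under eq_bigr do rewrite -sum1_card.
rewrite -partition_disjoint_bigcup.
  by rewrite sum1_card -[(q ^ t)%N](card_npoly K t) max_card.
move=> d d'; apply: contraR => /pred0Pn[_ /andP[/imsetP[x xD ->] /imsetP[x' xD' e]]].
have [e1 _] := f_eq _ _ _ _ xD xD' e.
by apply/eqP/val_inj; apply: succn_inj; rewrite -(size_r d x.1) e1 size_r.
Qed.

(** With [t = w + s], every length [t - k * d] in [sieve_count_sum] is still at least [w], so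
    periodicity pulls out the common factor [sieve_count K k y w]. *)
Lemma sieve_count_bound (w s : nat) : size W = w.+1 -> (k * y <= s)%N ->
  (sieve_count K k y w * \sum_(d < y.+1) q ^ (d + s - k * d) <= q ^ (w + s))%N.
Proof.
move=> sW kys.
have kds (d : 'I_y.+1) : (k * d <= s)%N.
  by rewrite (leq_trans _ kys) // leq_mul2l -ltnS ltn_ord orbT.
apply: leq_trans (sieve_count_sum (leq_trans kys (leq_addl w s))).
rewrite big_distrr /=; apply: leq_sum => d _.
by rewrite -(addnBA w (kds d)) sieve_count_periodic // mulnCA -expnD addnBA.
Qed.
End Sieve.

(** * Chinese remaindering and the covering polynomial *)

Lemma coprimep_prodl (F : fieldType) (I : Type) (s : seq I) (P : pred I)
    (G : I -> {poly F}) (p : {poly F}) :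
  (forall i, P i -> coprimep (G i) p) -> coprimep (\prod_(i <- s | P i) G i) p.
Proof.
move=> H; elim/big_ind: _ => [|a b ca cb|//]; first exact: coprime1p.
by rewrite coprimepMl ca.
Qed.

Lemma poly_crt (F : fieldType) (s : seq ({poly F} * {poly F})) :
  pairwise (fun a b => coprimep a.1 b.1) s ->
  exists G : {poly F}, forall a, a \in s -> a.1 %| G - a.2.
Proof.
elim: s => [|[M A] s IHs] /=; first by exists 0.
move=> /andP[/allP cM /IHs[G HG]].
pose N := \prod_(b <- s) b.1.
have cNM : coprimep N M.
  rewrite /N big_seq; apply: coprimep_prodl => b bs.
  by rewrite coprimep_sym; exact: cM.
have /Bezout_eq1_coprimepP[[u v] /= uv] := cNM.
(* Since [u * N + v * M = 1], the correction vanishes modulo every earlier modulus and moves [G] to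
   [A] modulo [M]. *)
exists (G + u * N * (A - G)) => a; rewrite inE => /predU1P[->|a_s] /=.
  have -> : G + u * N * (A - G) - A = - (v * (A - G) * M).
    by move/(canRL (addrK _)): uv => ->; ring.
  by rewrite dvdpNr dvdp_mulIr.
rewrite addrAC dvdp_addr ?HG // dvdp_mulr // dvdp_mull //.
by rewrite /N (big_rem a) //= dvdp_mulIl.
Qed.

Lemma predn_size_mul (F : fieldType) (p r : {poly F}) : p != 0 -> r != 0 ->
  (size (p * r)).-1 = ((size p).-1 + (size r).-1)%N.
Proof.
move=> pN0 rN0; rewrite size_mul //; move: pN0 rN0; rewrite -!size_poly_gt0.
by case: (size p) (size r) => [|a] [|b] //= _ _; rewrite addnS.
Qed.

Lemma predn_size_prod (F : fieldType) (I : eqType) (s : seq I) (G : I -> {poly F}) :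
  (forall i, i \in s -> G i != 0) ->
  (size (\prod_(i <- s) G i)).-1 = (\sum_(i <- s) (size (G i)).-1)%N.
Proof.
elim: s => [|i s IHs] H; first by rewrite !big_nil size_poly1.
have H' j : j \in s -> G j != 0 by move=> js; apply: H; rewrite inE js orbT.
rewrite !big_cons -IHs // predn_size_mul ?H ?mem_head //.
by rewrite prodf_seq_neq0; apply/allP.
Qed.

Lemma coprimep_irreducible (F : fieldType) (p p' : {poly F}) :
  p \is monic -> p' \is monic -> irreducible_poly p -> irreducible_poly p' ->
  p != p' -> coprimep p p'.
Proof.
move=> mp mp' ip ip' pp'; rewrite irreducible_poly_coprime //.
apply: contra pp' => pdvd; rewrite -eqp_monic //; apply: ip'.2 pdvd.
by rewrite gtn_eqF // ip.1.
Qed.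

(** At least [q^m / m] monic irreducibles have degree at most [m]; discarding those of degree at
    most [y] loses at most [q ^ y.+1]. *)
Lemma irreducibles_above (K : finFieldType) (m y U : nat) : (0 < m)%N ->
  (m * (U + #|K| ^ y.+1) <= #|K| ^ m)%N ->
  exists s : seq {poly K}, [/\ uniq s, (U <= size s)%N &
    forall p, p \in s -> [/\ p \is monic, irreducible_poly p,
                            (size p <= m.+1)%N & (y.+1 < size p)%N]].
Proof.
move=> m_gt0 hm.
have := leq_trans hm (many_irreducibles K m_gt0); rewrite leq_pmul2l //.
set S := [pred P | _] => hS.
pose T := [pred P : {poly_(m.+1) K} | (size (P : {poly K}) <= y.+1)%N].
have cT : (#|[predI S & T]| <= #|K| ^ y.+1)%N.
  rewrite -card_npoly.
  have inj : {in [predI S & T] &, injective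
      (fun P : {poly_(m.+1) K} => npolyp y.+1 (P : {poly K}))}.
    move=> P P' /andP[_ PT] /andP[_ PT'] /(congr1 (@polyn K y.+1)).
    by rewrite !npolypK // => /val_inj.
  by rewrite -(card_in_imset inj) max_card.
have cS := cardID T S.
exists [seq (P : {poly K}) | P : {poly_(m.+1) K} in [predD S & T]]; split.
- by rewrite map_inj_uniq ?enum_uniq //; exact: val_inj.
- rewrite size_map -cardE -(leq_add2r (#|K| ^ y.+1)) (leq_trans hS) // -cS.
  by rewrite addnC leq_add2l.
- move=> p /mapP[P]; rewrite mem_enum => /andP[PT /andP[mP /irreducibleP iP]] ->.
  by split=> //; rewrite ?size_npoly // ltnNge.
Qed.

(** Take [F = 0] modulo [W] and [F = -A] modulo [p A ^+ k] for each survivor [A]. Then [F + A] is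
    divisible by [p A ^+ k] if [A] survives, and otherwise by a small [P ^+ k] dividing both [F] and
    [A]. *)
Lemma covering_polynomial (K : finFieldType) (k y t m n : nat) :
  (0 < m)%N ->
  (m * (sieve_count K k y t + #|K| ^ y.+1) <= #|K| ^ m)%N ->
  ((size (sieve_modulus K k y)).-1 + k * (m * sieve_count K k y t) <= n)%N ->
  exists F : {poly K}, [/\ F \is monic, (size F <= n.+1)%N &
    forall Q : {poly K}, (size (F - Q)%R <= t)%N ->
      exists2 P : {poly K}, (1 < size P)%N & P ^+ k %| Q].
Proof.
move=> m_gt0 hm hn; set U := sieve_count K k y t in hm hn.
set W := sieve_modulus K k y in hn *.
have WN0 : W != 0 by exact: sieve_modulus_neq0.
have [Ps [Ps_uniq Ps_size PsP]] := irreducibles_above m_gt0 hm.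
pose Ul := [seq (A : {poly K}) | A : {poly_t K} in
  [pred A : {poly_t K} | kfree_upto k y A]].
have Ul_uniq : uniq Ul by rewrite map_inj_uniq ?enum_uniq //; exact: val_inj.
have Ul_size : size Ul = U by rewrite size_map -cardE.
have Ul_mem (A : {poly K}) : (size A <= t)%N -> kfree_upto k y A -> A \in Ul.
  move=> At Ak; apply/mapP; exists (npolyp t A); rewrite ?npolypK //.
  by rewrite mem_enum inE npolypK.
(* Each survivor gets the irreducible at its own position; [Ps] has no repetition, so the choice is
   injective. *)
pose p (A : {poly K}) := Ps`_(index A Ul).
have idx A : A \in Ul -> (index A Ul < size Ps)%N.
  by move=> AU; rewrite (leq_trans _ Ps_size) // -Ul_size index_mem.
have pP A : A \in Ul -> [/\ p A \is monic, irreducible_poly (p A),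
    (size (p A) <= m.+1)%N & (y.+1 < size (p A))%N].
  by move=> AU; apply: PsP; rewrite mem_nth ?idx.
have p_inj : {in Ul &, injective p}.
  move=> A B AU BU /eqP; rewrite nth_uniq ?idx // => /eqP e.
  by rewrite -(nth_index 0 AU) e nth_index.
pose sys : seq ({poly K} * {poly K}) := (W, 0) :: [seq (p A ^+ k, - A) | A <- Ul].
have [G HG] : exists G : {poly K}, forall a, a \in sys -> a.1 %| G - a.2.
  apply: poly_crt; rewrite /= pairwise_map; apply/andP; split.
    apply/allP => _ /mapP[A AU ->] /=.
    have [_ ip _ sp] := pP A AU.
    (* [p A] has degree above [y], so it divides no nonzero factor [P] of [W]. *)
    apply: coprimep_prodl => P PN0; apply: coprimep_expl; apply: coprimep_expr.
    rewrite coprimep_sym irreducible_poly_coprime //.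
    by apply/negP => /(dvdp_leq PN0); rewrite leqNgt (leq_ltn_trans (size_npoly P) sp).
  move: (Ul_uniq); rewrite uniq_pairwise;
  apply: (@sub_in_pairwise _ (mem Ul)); last exact/allP.
  move=> A B AU BU /= AB.
  have [mA iA _ _] := pP A AU; have [mB iB _ _] := pP B BU.
  apply: coprimep_expl; apply: coprimep_expr; apply: coprimep_irreducible => //.
  by apply: contra AB => /eqP/p_inj ->.
pose Pi := W * \prod_(A <- Ul) p A ^+ k.
have pN0 A : A \in Ul -> p A ^+ k != 0.
  by move=> /pP[mA _ _ _]; rewrite expf_neq0 ?monic_neq0.
have prodN0 : \prod_(A <- Ul) p A ^+ k != 0 by rewrite prodf_seq_neq0; apply/allP.
have PiN0 : Pi != 0 by rewrite mulf_neq0.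
have lcN0 : (lead_coef Pi)^-1 != 0 by rewrite invr_eq0 lead_coef_eq0.
have sPi : (size Pi <= n.+1)%N.
  rewrite -[size Pi]prednK ?size_poly_gt0 // predn_size_mul // ltnS (leq_trans _ hn) //.
  rewrite leq_add2l predn_size_prod // -Ul_size mulnA.
  rewrite mulnC -sum1_size big_distrl /= big_seq [in X in (_ <= X)%N]big_seq.
  apply: leq_sum => A /pP[_ _ sA _]; rewrite size_exp mul1n mulnC leq_mul2l.
  by rewrite -subn1 leq_subLR add1n sA orbT.
(* Adding the normalized [Pi] to the remainder keeps all congruences and makes [F] monic of the
   degree of [Pi]. *)
pose F := (lead_coef Pi)^-1 *: Pi + G %% Pi.
have sGF : (size (G %% Pi)%R < size ((lead_coef Pi)^-1 *: Pi)%R)%N.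
  by rewrite size_scale // ltn_modp.
have FP a : a \in sys -> a.1 %| F - a.2.
  move=> a_sys.
  have aPi : a.1 %| Pi.
    move: a_sys; rewrite inE => /predU1P[->|/mapP[A AU ->]] /=.
      by rewrite dvdp_mulr.
    by rewrite dvdp_mull // (big_rem A) //= dvdp_mulr.
  have -> : F - a.2 = (G - a.2) + ((lead_coef Pi)^-1 *: Pi - G %/ Pi * Pi).
    by rewrite {1}(divp_eq G Pi) /F; ring.
  by rewrite dvdp_addr ?HG // dvdp_sub ?dvdpZr // dvdp_mull.
exists F; split.
- by rewrite monicE lead_coefDl // lead_coefZ mulVf // -invr_eq0.
- by rewrite size_polyDl // size_scale.
move=> Q FQ; pose A := Q - F.
have QE : Q = F + A by rewrite addrC subrK.
have sA : (size A <= t)%N by rewrite -size_polyN opprB.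
have [Ak|] := boolP (kfree_upto k y A).
  have AU := Ul_mem A sA Ak; have [_ iA _ _] := pP A AU.
  exists (p A); first exact: iA.1.
  rewrite QE -[A in F + A]opprK; apply: (FP (p A ^+ k, - A)).
  by rewrite inE; apply/orP; right; apply/mapP; exists A.
rewrite negb_forall => /existsP[P]; rewrite negb_imply negbK => /andP[P1 PA].
exists (P : {poly K}) => //; rewrite QE dvdp_addl //.
have := FP (W, 0) (mem_head _ _); rewrite subr0; apply: dvdp_trans.
by rewrite dvdp_sieve_modulus ?size_npoly // -size_poly_gt0 ltnW.
Qed.

(** * Real estimates *)

Lemma exp2_ge_linear (R : realType) (C : R) :
  exists a0 : nat, forall a : nat, (a0 <= a)%N -> C * a.+1%:R <= 2 ^+ a.
Proof.
have sq a : (a * a.+1 <= 2 ^ a.+1)%N.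
  elim: a => // a IHa.
  have := ltn_expl a (isT : 1 < 2)%N; rewrite [(2 ^ a.+2)%N]expnS; rewrite expnS in IHa *; nia.
(* The factor 2 absorbs the extra one in the exponent of [sq]. *)
exists (2 * (Num.truncn C).+1)%N => a ha.
have hC : C <= (Num.truncn C).+1%:R by rewrite ltW // truncnS_gt.
apply: (@le_trans _ _ ((Num.truncn C).+1%:R * a.+1%:R)); first by rewrite ler_wpM2r.
rewrite -natrM -natrX ler_nat -(leq_pmul2l (isT : 0 < 2)%N) -expnS mulnA.
by rewrite (leq_trans _ (sq a)) // leq_mul2r ha.
Qed.

Lemma zetaqE (R : realType) (q k : nat) : (0 < q)%N ->
  zetaq q k%:R = (1 - q%:R / q%:R ^+ k)^-1 :> R.
Proof.
move=> q_gt0; rewrite /zetaq.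
have qN0 : q%:R != 0 :> R by rewrite pnatr_eq0 -lt0n.
by rewrite powRD ?qN0 ?implybT // powRr1 // powRN powR_mulrn.
Qed.

(** The partial sum is [(1 - r^(y+1)) / (1 - r)], and [r^(y+1)] tends to 0. *)
Lemma geometric_sum_gt (R : realType) (r x : R) : 0 <= r -> r < 1 ->
  x < (1 - r)^-1 -> exists y : nat, x < \sum_(d < y.+1) r ^+ d.
Proof.
move=> r0 r1 hx.
have r1' : 0 < 1 - r by rewrite subr_gt0.
have e_gt0 : 0 < 1 - x * (1 - r) by rewrite subr_gt0 -ltr_pdivlMr // div1r.
have : \forall y \near \oo, r ^+ y < 1 - x * (1 - r).
  apply: cvgr_lt e_gt0; apply: cvg_expr; by rewrite ger0_norm.
case=> y _ hy; exists y; have := hy y.+1 (leqnSn y).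
have := subrX1 r y.+1; move: (\sum_(d < y.+1) _) => z.
by nra.
Qed.

Lemma logq_trunc_log (R : realType) (q n : nat) : (1 < q)%N -> (0 < n)%N ->
  (trunc_log q n)%:R <= logq q n%:R :> R /\
  logq q n%:R <= (trunc_log q n).+1%:R :> R.
Proof.
move=> q1 n0; have lnq : 0 < ln q%:R :> R by rewrite ln_gt0 // ltr1n.
have q_gt0 := ltnW q1; have q0 : 0 < q%:R :> R by rewrite ltr0n.
have /andP[h1 h2] := trunc_log_bounds q1 n0.
rewrite /logq; split.
  rewrite ler_pdivlMr // mulr_natl -lnXn // ler_ln ?posrE ?exprn_gt0 ?ltr0n //.
  by rewrite -natrX ler_nat.
rewrite ler_pdivrMr // mulr_natl -lnXn // ler_ln ?posrE ?exprn_gt0 ?ltr0n //.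
by rewrite -natrX ler_nat ltnW.
Qed.

(** This is [sieve_count_bound] rescaled: [q^(d + s - k d) = q^s (q / q^k)^d]. *)
Lemma sieve_count_density (R : realType) (K : finFieldType) (k y w s : nat) :
  size (sieve_modulus K k y) = w.+1 -> (k * y <= s)%N ->
  (sieve_count K k y (w + s))%:R *
    \sum_(d < y.+1) (#|K|%:R / #|K|%:R ^+ k) ^+ d <= #|K|%:R ^+ (w + s) :> R.
Proof.
move=> sW kys; have q0 : #|K|%:R != 0 :> R.
  by rewrite pnatr_eq0 gtn_eqF // (ltnW (finNzRing_gt1 K)).
rewrite (sieve_count_periodic _ sW).
apply: (@le_trans _ _
  (sieve_count K k y w * \sum_(d < y.+1) #|K| ^ (d + s - k * d))%N%:R); last first.
  by rewrite -natrX ler_nat sieve_count_bound.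
rewrite !natrM -mulrA ler_wpM2l ?ler0n // natr_sum mulr_sumr ler_sum // => d _.
have kds : (k * d <= d + s)%N.
  by rewrite (leq_trans _ (leq_addl _ _)) // (leq_trans _ kys) // leq_mul2l -ltnS ltn_ord orbT.
rewrite !natrX expr_div_n -exprM mulrA -exprD addnC.
by rewrite ler_pdivrMr ?exprn_gt0 ?lt0r ?q0 ?ler0n // -exprD subnK.
Qed.

(** Supplies enough irreducibles of degree at most [a + j], with [Qa = q^a], [Qj = q^j],
    [B = q^(y+1)]: the left side is at most [2a(U + B) <= 2cn + Qa <= (2cq + 1) Qa]. *)
Lemma supply_bound (R : realFieldType) (a j U B q c n Qa Qj : R) :
  j <= a -> 0 <= U -> 0 <= B -> 0 <= c -> 0 <= Qa ->
  U * a <= c * n -> n <= q * Qa -> 2 * B * (a + 1) <= Qa -> 2 * c * q + 1 <= Qj ->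
  (a + j) * (U + B) <= Qa * Qj.
Proof.
move=> ja U0 B0 c0 Qa0 Ua nq hB hQj.
have h1 : (a + j) * (U + B) <= 2 * a * (U + B).
  by rewrite ler_wpM2r ?addr_ge0 //; lra.
have h2 : c * n <= c * (q * Qa) by rewrite ler_wpM2l.
have h3 : Qa * (2 * c * q + 1) <= Qa * Qj by rewrite ler_wpM2l.
nra.
Qed.

(** The main term [k U a] takes [(1 - e) n]; the terms [w] and [k U j] take at most [e n / 2]
    each. *)
Lemma degree_bound (R : realFieldType) (a j U k w e n : R) :
  0 <= U -> 0 <= k -> 0 <= e -> 0 <= n ->
  k * (U * a) <= (1 - e) * n -> 2 * j <= e * a -> 2 * w <= e * n ->
  w + k * ((a + j) * U) <= n.
Proof.
move=> U0 k0 e0 n0 kUa hj hw.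
have h1 : (k * U) * (2 * j) <= (k * U) * (e * a) by rewrite ler_wpM2l ?mulr_ge0.
have h2 : e * (k * (U * a)) <= e * ((1 - e) * n) by rewrite ler_wpM2l.
have h3 : 0 <= e * e * n by rewrite !mulr_ge0.
nra.
Qed.

(** * Choice of parameters and conclusion *)

Theorem theorem1p1 (R : realType) (k q : nat) (K : finFieldType) (c : R)
    (hk : (2 <= k)%N) (hq : #|K| = q) (hc : k%:R * c < zetaq q k%:R) :
  exists n0 : nat, forall n : nat, (n0 <= n)%N ->
    exists F : {poly K},
      [/\ F \is monic,
          (size F <= n.+1)%N
        & forall h : nat,
            q%:R ^+ h.+1 <= c * n%:R / logq q n%:R ->
            forall Q : {poly K}, poly_interval F h Q -> ~ kfree k Q].
Proof.
have q_gt1 : (1 < q)%N by rewrite -hq finNzRing_gt1.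
have q_gt0 : 0 < q%:R :> R by rewrite ltr0n ltnW.
have q_gt1R : 1 < q%:R :> R by rewrite ltr1n.
have [c_le0|c_gt0] := leP c 0.
  (* For [c <= 0] the bound on [q ^ h.+1] is at most 0 (at [n = 1] the quotient by [logq q 1 = 0] is
     0), so no [h] qualifies and [F = 1] works vacuously. *)
  exists 1%N => n n_gt0; exists 1; split; rewrite ?monic1 ?size_poly1 // => h.
  rewrite leNgt; case/negP; apply: le_lt_trans (exprn_gt0 h.+1 q_gt0).
  have [L0 _] := logq_trunc_log R q_gt1 n_gt0.
  rewrite mulr_le0_ge0 ?mulr_le0_ge0 ?ler0n // invr_ge0.
  by rewrite (le_trans _ L0).
pose rho : R := q%:R / q%:R ^+ k.
have rho_ge0 : 0 <= rho by rewrite divr_ge0 ?exprn_ge0 ?ler0n.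
have rho_lt1 : rho < 1.
  by rewrite ltr_pdivrMr ?exprn_gt0 // mul1r -{1}[q%:R]expr1 ltr_eXn2l.
have [y hy] : exists y : nat, k%:R * c < \sum_(d < y.+1) rho ^+ d.
  by apply: geometric_sum_gt => //; rewrite -zetaqE // ltnW.
set Z := \sum_(d < y.+1) _ in hy.
have Z_ge1 : 1 <= Z.
  rewrite /Z big_ord_recl expr0 lerDl; apply: sumr_ge0 => d _; exact: exprn_ge0.
have Z_gt0 : 0 < Z by rewrite (lt_le_trans ltr01).
pose w := (size (sieve_modulus K k y)).-1.
have sW : size (sieve_modulus K k y) = w.+1.
  by rewrite prednK // size_poly_gt0 sieve_modulus_neq0.
(* [e] is the proportion of the degree budget [n] left over by the main term [k c n / Z]. *)
pose e := 1 - k%:R * c / Z.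
have e_gt0 : 0 < e by rewrite subr_gt0 ltr_pdivrMr ?mul1r.
pose j := (Num.truncn (2 * c * q%:R + 1)).+1.
have hj : 2 * c * q%:R + 1 <= q%:R ^+ j.
  rewrite (le_trans (ltW (truncnS_gt _))) // -natrX ler_nat.
  by rewrite ltnW // ltn_expl.
(* Thresholds for [a]: [a1] covers the discarded irreducibles of degree at most [y], [a2] ensures
   [t >= w + k * y], [a3] ensures [2 w <= e n], and [b] ensures [2 j <= e a]. *)
have [a1 ha1] := exp2_ge_linear (2 * (q ^ y.+1)%:R : R).
have [a2 ha2] := exp2_ge_linear (q%:R ^+ (w + k * y) / c : R).
have [a3 ha3] := exp2_ge_linear (2 * w%:R / e : R).
pose b := (Num.truncn (2 * j%:R / e)).+1.
pose a0 := maxn a1 (maxn a2 (maxn a3 (maxn j b))).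
have [a0_1 a0_2 a0_3 a0_j a0_b] :
    [/\ (a1 <= a0)%N, (a2 <= a0)%N, (a3 <= a0)%N, (j <= a0)%N & (b <= a0)%N].
  by split; rewrite !leq_max leqnn ?orbT.
exists (q ^ a0)%N => n hn.
have n_gt0 : (0 < n)%N by rewrite (leq_trans _ hn) // expn_gt0 ltnW.
pose a := trunc_log q n; pose L : R := logq q n%:R.
have [aL La] : a%:R <= L /\ L <= a.+1%:R := logq_trunc_log R q_gt1 n_gt0.
have /andP[an nS] := trunc_log_bounds q_gt1 n_gt0; rewrite -/a in an nS.
have a0a : (a0 <= a)%N by rewrite trunc_log_max.
have j_le : (j <= a)%N by rewrite (leq_trans _ a0a).
have a_gt0 : (0 < a)%N by rewrite (leq_trans _ j_le).
have qa : 2 ^+ a <= q%:R ^+ a :> R by rewrite lerXn2r ?nnegrE ?ler_nat ?ler0n.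
have qan : q%:R ^+ a <= n%:R :> R by rewrite -natrX ler_nat.
have nqa : n%:R <= q%:R * q%:R ^+ a :> R by rewrite -exprS -natrX ler_nat ltnW.
have E1 : 2 * (q ^ y.+1)%:R * a.+1%:R <= q%:R ^+ a :> R.
  by apply: le_trans qa; apply/ha1/(leq_trans a0_1).
have E2 : q%:R ^+ (w + k * y) * a.+1%:R <= c * n%:R.
  have := le_trans (ha2 a (leq_trans a0_2 a0a)) (le_trans qa qan).
  by rewrite mulrAC ler_pdivrMr // [n%:R * c]mulrC.
have E3 : 2 * w%:R <= e * n%:R.
  rewrite -ler_pdivrMl // mulrC.
  apply: le_trans qan; apply: le_trans qa.
  apply: le_trans (ha3 a (leq_trans a0_3 a0a)).
  by rewrite ler_peMr ?ler1n // divr_ge0 ?mulr_ge0 ?ler0n // ltW.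
have E4 : 2 * j%:R <= e * a%:R.
  rewrite -ler_pdivrMl // mulrC (le_trans (ltW (truncnS_gt _))) // ler_nat.
  exact: leq_trans a0a.
have L_gt0 : 0 < L by rewrite (lt_le_trans _ aL) // ltr0n.
pose X := c * n%:R / L.
have T0X : q%:R ^+ (w + k * y) <= X.
  by rewrite ler_pdivlMr // (le_trans _ E2) // ler_wpM2l // exprn_ge0 // ltW.
have X_ge1 : 1 <= X by rewrite (le_trans _ T0X) // exprn_ege1 // ltW.
have X_ge0 := le_trans ler01 X_ge1.
(* This turns the bound on [q ^ h.+1] into [h.+1 <= t], with [t] the largest exponent allowed;
   [1 <= X] keeps the truncation positive. *)
have leX (i : nat) : (q%:R ^+ i <= X) = (i <= trunc_log q (Num.truncn X))%N.
  apply/idP/idP => [iX|it].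
    by rewrite trunc_log_max // truncn_ge_nat // natrX.
  have X1 : (0 < Num.truncn X)%N by rewrite truncn_gt0.
  rewrite -natrX -truncn_ge_nat // (leq_trans _ (trunc_logP q_gt1 X1)) //.
  by rewrite leq_exp2l.
pose t := trunc_log q (Num.truncn X).
have T0t : (w + k * y <= t)%N by rewrite -leX.
have [s tE] : exists s, t = (w + s)%N
  by exists (t - w)%N; rewrite subnKC // (leq_trans (leq_addr _ _) T0t).
pose U := sieve_count K k y t.
have UZ : U%:R * Z <= q%:R ^+ t.
  by rewrite /U /Z /rho -hq tE sieve_count_density // -(leq_add2l w) -tE.
have tX : q%:R ^+ t * L <= c * n%:R by rewrite -ler_pdivlMr // leX.
(* Combines [U Z <= q^t] with [a <= L] and [q^t L <= c n]. *)
have UZa : U%:R * Z * a%:R <= c * n%:R.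
  by rewrite (le_trans _ tX) // ler_pM ?mulr_ge0 ?ler0n // ltW.
have Ua : U%:R * a%:R <= c * n%:R.
  by rewrite (le_trans _ UZa) // ler_wpM2r ?ler0n // ler_peMr ?ler0n.
have kUa : k%:R * (U%:R * a%:R) <= (1 - e) * n%:R.
  have -> : (1 - e) * n%:R = k%:R * (c * n%:R / Z) by rewrite /e; field; rewrite gt_eqF.
  by rewrite ler_wpM2l ?ler0n // ler_pdivlMr // mulrAC.
have Um : ((a + j) * (U + #|K| ^ y.+1) <= #|K| ^ (a + j))%N.
  rewrite hq expnD -(ler_nat R) !natrM !natrD (natrX _ q a) (natrX _ q j).
  apply: (supply_bound (c := c) (q := q%:R) (n := n%:R)); rewrite ?natr1 ?ler0n ?ler_nat //.
  exact: ltW.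
have Un : ((size (sieve_modulus K k y)).-1 + k * ((a + j) * U) <= n)%N.
  rewrite -/w -(ler_nat R) natrD !natrM natrD.
  by apply: (degree_bound (e := e)); rewrite ?ler0n // ltW.
(* The irreducibles are taken of degree at most [m = a + j], that is [log_q n + O(1)]. *)
have [F [mF sF HF]] := covering_polynomial (ltn_addr j a_gt0) Um Un.
exists F; split=> // h; rewrite leX => ht Q hQ Qk.
have [P P1 PQ] := HF Q (leq_trans hQ ht).
by have := Qk P P1; rewrite PQ.
Qed.
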